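(* For any matrix group $G$ whose matrix entries are computable numbers, $\mathfrak{L}(G)^w_{O(n)} \subsetneq \mathsf{RE}$.
   Context: For a group $G$ with identity $e$, a $G$-automaton is a tuple $(Q,\Sigma,G,\delta,q_0,Q_a)$ where $Q$ is a finite set of states, $\Sigma$ a finite input alphabet, $q_0\in Q$ the initial state, $Q_a\subseteq Q$ the accepting states, and $\delta$ assigns to each $(q,\sigma)\in Q\times(\Sigma\cup\{\varepsilon\})$ a finite set of pairs $(q',m)\in Q\times G$. The register holds an element of $G$, initially $e$; using a transition $(q',m)\in\delta(q,\sigma)$ (one step) the automaton reads $\sigma$ (or nothing), moves to $q'$ and replaces the register content $x$ by $xm$. A word is accepted if some computation reads it entirely and ends in an accepting state with register equal to $e$. A $G$-automaton recognizing $\mathtt{L}$ is weakly $t(n)$ time-bounded if every $x\in\mathtt{L}$ with $|x|=n$ has an accepting computation of at most $t(n)$ steps; $\mathfrak{L}(G)^w_{O(n)}$ is the class of languages recognized by weakly $t(n)$ time-bounded $G$-automata for some $t(n)=O(n)$. $\mathsf{RE}$ is the class of recursively enumerable languages. *)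

(* Defs.v *)
From HB Require Import structures.
From mathcomp Require Import all_boot all_order all_algebra.
From mathcomp Require Import complex.
From mathcomp Require Import Rstruct.
Set Implicit Arguments. Unset Strict Implicit. Unset Printing Implicit Defensive.
Import Order.TTheory GRing.Theory Num.Theory.
Local Open Scope ring_scope.

Inductive recf : Type :=
| RZero : recf
| RSucc : recf
| RProj : nat -> recf
| RComp : recf -> list recf -> recf
| RPrim : recf -> recf -> recf
| RMin  : recf -> recf.

Inductive eval : recf -> seq nat -> nat -> Prop :=
| ev_zero xs : eval RZero xs 0
| ev_succ xs : eval RSucc xs (head 0 xs).+1
| ev_proj i xs : eval (RProj i) xs (nth 0 xs i)
| ev_comp f gs xs ys y :
    evals gs xs ys -> eval f ys y -> eval (RComp f gs) xs y
| ev_prim0 f g xs y : eval f xs y -> eval (RPrim f g) (0 :: xs) y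
| ev_primS f g n xs z y :
    eval (RPrim f g) (n :: xs) z -> eval g (n :: z :: xs) y ->
    eval (RPrim f g) (n.+1 :: xs) y
| ev_min f xs n :
    eval f (n :: xs) 0 ->
    (forall m, (m < n)%N -> exists v, eval f (m :: xs) v.+1) ->
    eval (RMin f) xs n
with evals : list recf -> seq nat -> seq nat -> Prop :=
| evs_nil xs : evals nil xs [::]
| evs_cons g gs xs y ys : eval g xs y -> evals gs xs ys -> evals (g :: gs) xs (y :: ys).

(* Standard injective (bijective base-(|S|+1)) coding of words as naturals *)
Definition code_word (S : finType) (w : seq S) : nat :=
  foldr (fun a acc => ((enum_rank a).+1 + #|S|.+1 * acc)%N) 0 w.

Definition RE (S : finType) (L : seq S -> Prop) : Prop :=
  exists f : recf, forall w : seq S, L w <-> exists y, eval f [:: code_word w] y.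

Definition computable_real (x : Rdefinitions.R) : Prop :=
  exists fs fa fd : recf, forall n : nat, exists s a d : nat,
    [/\ eval fs [:: n] s, eval fa [:: n] a, eval fd [:: n] d &
        `| x - (-1) ^+ s * a%:R / d.+1%:R | <= 2%:R ^- n].

Notation Cplx := (complex Rdefinitions.R).

Definition computable_complex (z : Cplx) : Prop :=
  computable_real (complex.Re z) /\ computable_real (complex.Im z).

Definition is_matrix_group (k : nat) (G : 'M[Cplx]_k -> Prop) : Prop :=
  [/\ G 1%:M,
      (forall A, G A -> A \in unitmx),
      (forall A B, G A -> G B -> G (A *m B)) &
      (forall A, G A -> G (invmx A))].

Record GAutomaton (k : nat) (G : 'M[Cplx]_k -> Prop) (S : finType) := {
  gstate : finType;
  (* delta q None = epsilon transitions; delta q (Some a) = transitions reading a *)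
  gdelta : gstate -> option S -> seq (gstate * 'M[Cplx]_k);
  gstart : gstate;
  gaccept : {set gstate};
  gdelta_in : forall q a p, p \in gdelta q a -> G p.2
}.

Inductive reach k G S (A : @GAutomaton k G S) :
  gstate A -> 'M[Cplx]_k -> seq S -> nat -> gstate A -> 'M[Cplx]_k -> Prop :=
| reach_nil q x : @reach k G S A q x [::] 0 q x
| reach_eps q x q2 m w n q' x' :
    (q2, m) \in gdelta q None -> @reach k G S A q2 (x *m m) w n q' x' ->
    @reach k G S A q x w n.+1 q' x'
| reach_sym q x a q2 m w n q' x' :
    (q2, m) \in gdelta q (Some a) -> @reach k G S A q2 (x *m m) w n q' x' ->
    @reach k G S A q x (a :: w) n.+1 q' x'.

Definition accepts_in k G S (A : @GAutomaton k G S) (w : seq S) (n : nat) : Prop :=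
  exists qf, qf \in gaccept A /\ reach (gstart A) 1%:M w n qf 1%:M.

Definition recognizes k G S (A : @GAutomaton k G S) (L : seq S -> Prop) : Prop :=
  forall w, L w <-> exists n, accepts_in A w n.

Definition weakly_time_bounded k G S (A : @GAutomaton k G S)
    (L : seq S -> Prop) (t : nat -> nat) : Prop :=
  recognizes A L /\ forall w, L w -> exists n, (n <= t (size w))%N /\ accepts_in A w n.

Definition bigO_lin (t : nat -> nat) : Prop :=
  exists c n0 : nat, forall n, (n0 <= n)%N -> (t n <= c * n)%N.

Definition LGw_lin k (G : 'M[Cplx]_k -> Prop) (S : finType) (L : seq S -> Prop) : Prop :=
  exists (A : @GAutomaton k G S) (t : nat -> nat),
    bigO_lin t /\ weakly_time_bounded A L t.

(* Main.v *)
Require Import Defs.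
From mathcomp Require Import all_boot all_order all_algebra.
From mathcomp Require Import complex Rstruct boolp zify ring.
Set Implicit Arguments. Unset Strict Implicit. Unset Printing Implicit Defensive.

(* The finitely many matrix entries occurring in an automaton generate a
   subring of the complex numbers in which zero testing is primitive recursive:
   adjoin them to the integers one at a time, each being either transcendental
   over what precedes (a polynomial vanishes iff its coefficients do) or a root
   of a nonzero polynomial of least degree (reduce by pseudo-division). With a
   linear bound on the number of steps, acceptance becomes a bounded search, so
   every language of the class is primitive recursive. A universal machine for
   primitive recursive programs and a diagonal argument give an r.e. language
   over a unary alphabet outside the class. *)

(** * Primitive recursive functions of one argument *)

Fixpoint tri n := if n is m.+1 then tri m + n else 0.

(** Cantor's pairing: the pairs with sum [s] fill the codes from [tri s] to [tri s + s]. *)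
Definition cpair a b := tri (a + b) + b.

(** The antidiagonal containing [n]. The outer truncated difference is 1 exactly when [m.+1] has
    reached [tri s.+1], so one counting loop inverts the pairing without a search. *)
Definition diag n := iteri n (fun m s => s + (1 - (tri s.+1 - m.+1))) 0.

Definition csnd n := n - tri (diag n).

Definition cfst n := diag n - csnd n.

Lemma leq_tri m n : m <= n -> tri m <= tri n.
Proof.
elim: n => [|n IH]; first by rewrite leqn0 => /eqP ->.
by rewrite leq_eqVlt => /predU1P[-> //|/IH h]; apply: leq_trans h (leq_addr _ _).
Qed.

Lemma diag_bounds n : tri (diag n) <= n < tri (diag n).+1.
Proof.
elim: n => [//|n /andP[IH1 IH2]].
rewrite /diag iteriS -/(diag n).
move: IH1 IH2; rewrite /= => IH1 IH2.
case: (leqP (tri (diag n).+1) n.+1) => /= h.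
  have -> : 1 - (tri (diag n) + (diag n).+1 - n.+1) = 1 by lia.
  by rewrite addn1 /=; lia.
have -> : 1 - (tri (diag n) + (diag n).+1 - n.+1) = 0 by lia.
by rewrite addn0; lia.
Qed.

Lemma diag_uniq n s : tri s <= n < tri s.+1 -> diag n = s.
Proof.
move=> h; have := diag_bounds n.
have h1 := @leq_tri s.+1 (diag n); have h2 := @leq_tri (diag n).+1 s.
by case: (ltngtP s (diag n)) => // hs; [have := h1 hs | have := h2 hs]; lia.
Qed.

Lemma diag_pair a b : diag (cpair a b) = a + b.
Proof. by apply: diag_uniq; rewrite /cpair /=; lia. Qed.

Lemma csndK a b : csnd (cpair a b) = b.
Proof. by rewrite /csnd diag_pair /cpair; lia. Qed.

Lemma cfstK a b : cfst (cpair a b) = a.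
Proof. by rewrite /cfst csndK diag_pair; lia. Qed.

Lemma cpairK n : cpair (cfst n) (csnd n) = n.
Proof.
have := diag_bounds n; rewrite /= => h.
have h1 : csnd n <= diag n by rewrite /csnd; lia.
have -> : cpair (cfst n) (csnd n) = tri (diag n) + csnd n.
  by rewrite /cpair /cfst subnK.
by rewrite /csnd; lia.
Qed.

Lemma leq_cpair a a' b b' : a <= a' -> b <= b' -> cpair a b <= cpair a' b'.
Proof. by move=> ha hb; rewrite leq_add // leq_tri // leq_add. Qed.

Lemma leq_csnd n : csnd n <= n.
Proof. by rewrite leq_subr. Qed.

(** All arguments are packed into one number, which keeps the language small enough for a short
    universal machine; iteration on pairs recovers primitive recursion. *)
Inductive prog :=
| PZero | PSucc | PFst | PSnd
| PComp of prog & prog | PPair of prog & prog | PIter of prog.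

Fixpoint den p x :=
  match p with
  | PZero => 0
  | PSucc => x.+1
  | PFst => cfst x
  | PSnd => csnd x
  | PComp p q => den p (den q x)
  | PPair p q => cpair (den p x) (den q x)
  | PIter p => iter (csnd x) (den p) (cfst x)
  end.

Definition primrec (f : nat -> nat) := exists p, den p =1 f.

Definition primrec2 (f : nat -> nat -> nat) := primrec (fun z => f (cfst z) (csnd z)).

Lemma eq_pr f g : f =1 g -> primrec f -> primrec g.
Proof. by move=> e [p hp]; exists p => x; rewrite hp. Qed.

Lemma pr_id : primrec (fun x => x).
Proof. by exists (PPair PFst PSnd) => x /=; rewrite cpairK. Qed.

Lemma pr_app (f g : nat -> nat) : primrec f -> primrec g -> primrec (fun x => f (g x)).
Proof. by move=> [p hp] [q hq]; exists (PComp p q) => x /=; rewrite hp hq. Qed.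

Lemma pr_succ f : primrec f -> primrec (fun x => (f x).+1).
Proof. by move=> [p hp]; exists (PComp PSucc p) => x /=; rewrite hp. Qed.

Lemma pr_const c : primrec (fun _ => c).
Proof. by elim: c => [|c IH]; [exists PZero | exact: pr_succ]. Qed.

Lemma pr_fst f : primrec f -> primrec (fun x => cfst (f x)).
Proof. by move=> [p hp]; exists (PComp PFst p) => x /=; rewrite hp. Qed.

Lemma pr_snd f : primrec f -> primrec (fun x => csnd (f x)).
Proof. by move=> [p hp]; exists (PComp PSnd p) => x /=; rewrite hp. Qed.

Lemma pr_pair f g : primrec f -> primrec g -> primrec (fun x => cpair (f x) (g x)).
Proof. by move=> [p hp] [q hq]; exists (PPair p q) => x /=; rewrite hp hq. Qed.

Lemma pr_app2 f g h : primrec2 f -> primrec g -> primrec h -> primrec (fun x => f (g x) (h x)).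
Proof.
move=> hf hg hh; apply: eq_pr (pr_app hf (pr_pair hg hh)) => x /=.
by rewrite cfstK csndK.
Qed.

(** [PIter] iterates one fixed function, so the loop state carries the parameter [x] and the counter
    next to the accumulated value. *)
Lemma pr_iteri N b (s : nat -> nat -> nat -> nat) :
  primrec N -> primrec b ->
  primrec (fun z => s (cfst z) (cfst (csnd z)) (csnd (csnd z))) ->
  primrec (fun x => iteri (N x) (s x) (b x)).
Proof.
move=> hN hb hs.
have [p hp] : primrec (fun z => cpair (cfst z) (cpair (cfst (csnd z)).+1
    (s (cfst z) (cfst (csnd z)) (csnd (csnd z))))).
  by do !apply: pr_pair => //; do ?apply: pr_succ; do !apply: pr_fst;
     try apply: pr_snd; exact: pr_id.
have hit : primrec (fun z => iter (csnd z) (den p) (cfst z)) by exists (PIter p).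
have h0 : primrec (fun x => cpair (cpair x (cpair 0 (b x))) (N x)).
  by do !apply: pr_pair => //; [exact: pr_id | exact: pr_const].
apply: eq_pr (pr_snd (pr_snd (pr_app hit h0))) => x.
rewrite cfstK csndK.
suff -> : iter (N x) (den p) (cpair x (cpair 0 (b x))) =
  cpair x (cpair (N x) (iteri (N x) (s x) (b x))) by rewrite !csndK.
by elim: (N x) => [//|n IH]; rewrite iterS IH hp !(cfstK, csndK).
Qed.

Lemma pr_ite (b : nat -> bool) f g :
  primrec (fun x => b x) -> primrec f -> primrec g ->
  primrec (fun x => if b x then f x else g x).
Proof.
move=> hb hf hg.
have h : primrec (fun x => iteri (b x) (fun _ _ => f x) (g x)).
  apply: (@pr_iteri _ _ (fun x _ _ => f x)) => //.
  exact: pr_app hf (pr_fst pr_id).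
by apply: eq_pr h => x; case: (b x).
Qed.

Lemma pr_pred f : primrec f -> primrec (fun x => (f x).-1).
Proof.
move=> hf; apply: (@eq_pr (fun x => iteri (f x) (fun n _ => n) 0)).
  by move=> x; case: (f x).
apply: (@pr_iteri _ _ (fun _ n _ => n)) => //; first exact: pr_const.
exact: pr_fst (pr_snd pr_id).
Qed.

Lemma pr_add f g : primrec f -> primrec g -> primrec (fun x => f x + g x).
Proof.
move=> hf hg; apply: (@eq_pr (fun x => iteri (f x) (fun _ n => n.+1) (g x))).
  by move=> x; elim: (f x) => [|n IH] //; rewrite iteriS IH.
apply: (@pr_iteri _ _ (fun _ _ n => n.+1)) => //.
exact: pr_succ (pr_snd (pr_snd pr_id)).
Qed.

Lemma pr_mul f g : primrec f -> primrec g -> primrec (fun x => f x * g x).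
Proof.
move=> hf hg; apply: (@eq_pr (fun x => iteri (f x) (fun _ n => g x + n) 0)).
  by move=> x; elim: (f x) => [|n IH] //; rewrite iteriS IH mulSn.
apply: (@pr_iteri _ _ (fun x _ n => g x + n)) => //; first exact: pr_const.
apply: pr_add; first exact: pr_app hg (pr_fst pr_id).
exact: (pr_snd (pr_snd pr_id)).
Qed.

Lemma pr_sub f g : primrec f -> primrec g -> primrec (fun x => f x - g x).
Proof.
move=> hf hg; apply: (@eq_pr (fun x => iteri (g x) (fun _ n => n.-1) (f x))).
  by move=> x; elim: (g x) => [|n IH]; rewrite ?subn0 // iteriS IH subnS.
apply: (@pr_iteri _ _ (fun x _ n => n.-1)) => //.
exact: pr_pred (pr_snd (pr_snd pr_id)).
Qed.

Lemma pr_eq f g : primrec f -> primrec g -> primrec (fun x => f x == g x).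
Proof.
move=> hf hg; apply: (@eq_pr (fun x => 1 - ((f x - g x) + (g x - f x)))).
  by move=> x; lia.
by do !(apply: pr_sub || apply: pr_add) => //; exact: pr_const.
Qed.

Lemma pr_and (b c : nat -> bool) :
  primrec (fun x => b x) -> primrec (fun x => c x) -> primrec (fun x => b x && c x).
Proof.
move=> hb hc; apply: eq_pr (pr_mul hb hc) => x.
by case: (b x) (c x) => [] [].
Qed.

Lemma pr_or (b c : nat -> bool) :
  primrec (fun x => b x) -> primrec (fun x => c x) -> primrec (fun x => b x || c x).
Proof.
move=> hb hc; have h := pr_sub (pr_add hb hc) (pr_mul hb hc).
by apply: eq_pr h => x; case: (b x) (c x) => [] [].
Qed.

(** * Bounded quantification and lists coded as numbers *)

Definition all_below n (P : nat -> bool) := all P (iota 0 n).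

Lemma all_belowP n (P : nat -> bool) : reflect (forall i, i < n -> P i) (all_below n P).
Proof.
by apply: (iffP allP) => h i; [move=> hi; apply: h | move=> hi; apply: h];
  move: hi; rewrite mem_iota.
Qed.

Lemma pr_all_below N (P : nat -> nat -> bool) :
  primrec N -> primrec2 (fun x i => P x i) -> primrec (fun x => all_below (N x) (P x)).
Proof.
move=> hN hP.
apply: (@eq_pr (fun x => iteri (N x) (fun i (r : nat) => P x i * r) 1)).
  move=> x; rewrite /all_below; elim: (N x) => [//|n IH].
  by rewrite iteriS IH -addn1 iotaD all_cat /= andbT andbC; case: (P x _) (all _ _) => [] [].
apply: (@pr_iteri _ _ (fun x i r => P x i * r)) => //; first exact: pr_const.
apply: pr_mul; last exact: pr_snd (pr_snd pr_id).
exact: (pr_app2 hP (pr_fst pr_id) (pr_fst (pr_snd pr_id))).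
Qed.

(** The successor keeps nonempty lists apart from the empty list 0. Every number is a list, and head
    and tail of 0 are 0. *)
Definition lcons a l := (cpair a l).+1.
Definition lhd l := cfst l.-1.
Definition ltl l := csnd l.-1.
Definition lnth l i := lhd (iter i ltl l).

Lemma lhdK a l : lhd (lcons a l) = a. Proof. exact: cfstK. Qed.
Lemma ltlK a l : ltl (lcons a l) = l. Proof. exact: csndK. Qed.
Lemma lnth0 a l : lnth (lcons a l) 0 = a. Proof. exact: lhdK. Qed.
Lemma lnthS a l i : lnth (lcons a l) i.+1 = lnth l i.
Proof. by rewrite /lnth iterSr ltlK. Qed.

(** Each tail strictly decreases a nonzero code, so a code bounds the length of its list. Later
    loops use the code itself as a length bound and rely on the default 0 past the end. *)
Lemma lnth_big l i : l <= i -> lnth l i = 0.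
Proof.
move=> h; rewrite /lnth; have -> : iter i ltl l = 0 by
  have : iter i ltl l <= l - i; [elim: i {h} => [|i IH]; rewrite ?subn0 // iterS |];
  [have := leq_csnd (iter i ltl l).-1; rewrite -/(ltl _); lia | lia].
by [].
Qed.

Lemma pr_cons f g : primrec f -> primrec g -> primrec (fun x => lcons (f x) (g x)).
Proof. by move=> hf hg; apply: pr_succ; apply: pr_pair. Qed.

Lemma pr_hd f : primrec f -> primrec (fun x => lhd (f x)).
Proof. by move=> hf; apply: pr_fst; apply: pr_pred. Qed.

Lemma pr_tl f : primrec f -> primrec (fun x => ltl (f x)).
Proof. by move=> hf; apply: pr_snd; apply: pr_pred. Qed.

Lemma pr_nth f g : primrec f -> primrec g -> primrec (fun x => lnth (f x) (g x)).
Proof.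
move=> hf hg; apply: pr_hd.
apply: (@eq_pr (fun x => iteri (g x) (fun _ l => ltl l) (f x))).
  by move=> x; elim: (g x) => // n IH; rewrite iteriS IH.
apply: (@pr_iteri _ _ (fun _ _ l => ltl l)) => //.
exact: pr_tl (pr_snd (pr_snd pr_id)).
Qed.

Definition larr s := foldr lcons 0 s.

Lemma lnth_arr s i : lnth (larr s) i = nth 0 s i.
Proof.
elim: s i => [|a s IH] [|i] //=; rewrite ?lnth0 ?lnthS //.
by rewrite lnth_big.
Qed.

Lemma pr_larr (T : Type) (s : seq T) (f : T -> nat -> nat) :
  (forall t, primrec (f t)) -> primrec (fun x => larr [seq f t x | t <- s]).
Proof.
move=> hf; elim: s => [|t s IH] /=; first exact: pr_const.
exact: pr_cons.
Qed.

Lemma pr_mkseq N (f : nat -> nat -> nat) :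
  primrec N -> primrec2 f -> primrec (fun x => larr (mkseq (f x) (N x))).
Proof.
move=> hN hf.
(* The list grows at its head, so the entries are produced from the last index down. *)
apply: (@eq_pr (fun x => iteri (N x) (fun i l => lcons (f x (N x - i.+1)) l) 0)).
  move=> x; suff h n : n <= N x -> iteri n (fun i l => lcons (f x (N x - i.+1)) l) 0
     = larr [seq f x i | i <- iota (N x - n) n].
    by rewrite h // subnn.
  elim: n => [//|n IH] hn; rewrite iteriS IH 1?ltnW //=.
  by rewrite (_ : (N x - n.+1).+1 = N x - n); last lia.
apply: (@pr_iteri _ _ (fun x i l => lcons (f x (N x - i.+1)) l)) => //.
  exact: pr_const.
apply: pr_cons; last exact: pr_snd (pr_snd pr_id).
apply: (pr_app2 hf); first exact: pr_fst pr_id.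
apply: pr_sub; first exact: pr_app hN (pr_fst pr_id).
exact: pr_succ (pr_fst (pr_snd pr_id)).
Qed.

Lemma lnth_mkseq f n i : lnth (larr (mkseq f n)) i = if i < n then f i else 0.
Proof.
rewrite lnth_arr; case: ltnP => h; first by rewrite nth_mkseq.
by rewrite nth_default // size_mkseq.
Qed.

Ltac pr_step :=
  first
  [ simple apply pr_id | simple apply pr_const
  | simple apply pr_cons | simple apply pr_hd | simple apply pr_tl
  | simple apply pr_nth
  | simple apply pr_fst | simple apply pr_snd | simple apply pr_pair
  | simple apply pr_pred
  | simple apply pr_add | simple apply pr_mul | simple apply pr_sub
  | simple apply pr_eq | simple apply pr_and | simple apply pr_or
  | simple apply pr_ite | simple apply pr_succ
  | match goal with
    | H : primrec2 ?f |- _ => refine (pr_app2 H _ _)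
    | H : primrec ?f |- _ => refine (pr_app H _)
    end ].
Ltac pr := repeat pr_step.

(** * Translation to recursive functions *)

Lemma eval_comp1 f g xs y z :
  eval g xs y -> eval f [:: y] z -> eval (RComp f [:: g]) xs z.
Proof. by move=> hg; apply: ev_comp; do !econstructor. Qed.

Lemma eval_comp2 f g h xs y z t : eval g xs y -> eval h xs z ->
  eval f [:: y; z] t -> eval (RComp f [:: g; h]) xs t.
Proof. by move=> hg hh; apply: ev_comp; do !econstructor. Qed.

Lemma eval_succ x xs y : y = x.+1 -> eval RSucc (x :: xs) y.
Proof. by move=> ->; exact: (ev_succ (x :: xs)). Qed.

Lemma eval_proj i xs y : y = nth 0 xs i -> eval (RProj i) xs y.
Proof. by move=> ->; constructor. Qed.

Lemma eval_prim f g xs n (h : nat -> nat -> nat) b :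
  eval f xs b -> (forall m z, eval g [:: m, z & xs] (h m z)) ->
  eval (RPrim f g) (n :: xs) (iteri n h b).
Proof.
by move=> hf hg; elim: n => [|n IH]; [constructor | econstructor; [exact: IH|]].
Qed.

Lemma eval_prim_eq f g xs n (h : nat -> nat -> nat) b y :
  eval f xs b -> (forall m z, eval g [:: m, z & xs] (h m z)) ->
  y = iteri n h b -> eval (RPrim f g) (n :: xs) y.
Proof. by move=> hf hg ->; exact: eval_prim. Qed.

Definition radd := RPrim (RProj 0) (RComp RSucc [:: RProj 1]).

Lemma eval_add a b : eval radd [:: a; b] (a + b).
Proof.
apply: (eval_prim_eq (h := fun _ z => z.+1) (b := b)); first exact: eval_proj.
  by move=> m z; apply: eval_comp1; [exact: eval_proj | exact: eval_succ].
by elim: a => [|a IH] //=; rewrite -IH addSn.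
Qed.

Definition rpred := RPrim RZero (RProj 0).

Lemma eval_pred a : eval rpred [:: a] a.-1.
Proof.
apply: (eval_prim_eq (h := fun m _ => m) (b := 0)); first exact: ev_zero.
  by move=> m z; exact: eval_proj.
by case: a.
Qed.

(** The subtrahend comes first because [RPrim] recurses on its first argument. *)
Definition rsub := RPrim (RProj 0) (RComp rpred [:: RProj 1]).

Lemma eval_sub a b : eval rsub [:: a; b] (b - a).
Proof.
apply: (eval_prim_eq (h := fun _ z => z.-1) (b := b)); first exact: eval_proj.
  by move=> m z; apply: eval_comp1; [exact: eval_proj | exact: eval_pred].
by elim: a => [|a IH] /=; rewrite ?subn0 // -IH subnS.
Qed.

Definition rtri :=
  RPrim RZero (RComp radd [:: RProj 1; RComp RSucc [:: RProj 0]]).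

Lemma eval_tri a xs : eval rtri (a :: xs) (tri a).
Proof.
apply: (eval_prim_eq (h := fun m z => z + m.+1) (b := 0)).
- exact: ev_zero.
- move=> m z; apply: eval_comp2; [exact: eval_proj| |exact: eval_add].
  by apply: eval_comp1; [exact: eval_proj | exact: eval_succ].
- by elim: a => [|a IH] //=; rewrite -IH.
Qed.

Definition rpair := RComp radd [:: RComp rtri [:: radd]; RProj 1].

Lemma eval_pair a b : eval rpair [:: a; b] (cpair a b).
Proof.
apply: eval_comp2; [|exact: eval_proj|exact: eval_add].
by apply: eval_comp1; [exact: eval_add | exact: eval_tri].
Qed.

Definition rdiag :=
  let rsucc i := RComp RSucc [:: RProj i] in
  RPrim RZero (RComp radd [:: RProj 1;
    RComp rsub [:: RComp rsub [:: rsucc 0; RComp rtri [:: rsucc 1]];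
                   RComp RSucc [:: RZero]]]).

Lemma eval_diag a : eval rdiag [:: a] (diag a).
Proof.
apply: eval_prim; first exact: ev_zero.
move=> m z; apply: eval_comp2; [exact: eval_proj| |exact: eval_add].
apply: eval_comp2; last exact: eval_sub; last first.
  by apply: eval_comp1; [exact: ev_zero | exact: eval_succ].
have hs i : eval (RComp RSucc [:: RProj i]) [:: m; z] (nth 0 [:: m; z] i).+1.
  by apply: eval_comp1; [exact: eval_proj | exact: eval_succ].
apply: eval_comp2; [exact: hs| |exact: eval_sub].
by apply: eval_comp1; [exact: hs | exact: eval_tri].
Qed.

Definition rsnd := RComp rsub [:: RComp rtri [:: rdiag]; RProj 0].

Lemma eval_snd a : eval rsnd [:: a] (csnd a).
Proof.
apply: eval_comp2; [|exact: eval_proj|exact: eval_sub].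
by apply: eval_comp1; [exact: eval_diag | exact: eval_tri].
Qed.

Definition rfst := RComp rsub [:: rsnd; rdiag].

Lemma eval_fst a : eval rfst [:: a] (cfst a).
Proof. by apply: eval_comp2; [exact: eval_snd|exact: eval_diag|exact: eval_sub]. Qed.

Lemma primrec_recf f : primrec f -> exists r, forall x, eval r [:: x] (f x).
Proof.
move=> [p hp]; suff [r hr] : exists r, forall x, eval r [:: x] (den p x).
  by exists r => x; rewrite -hp.
elim: p {f hp} => [||||p [r hr] q [s hs]|p [r hr] q [s hs]|p [r hr]] /=.
- by exists RZero => x; exact: ev_zero.
- by exists RSucc => x; exact: eval_succ.
- by exists rfst => x; exact: eval_fst.
- by exists rsnd => x; exact: eval_snd.
- by exists (RComp r [:: s]) => x; apply: eval_comp1 (hs x) (hr _).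
- by exists (RComp rpair [:: r; s]) => x; apply: eval_comp2 (hr x) (hs x) (eval_pair _ _).
- exists (RComp (RPrim (RProj 0) (RComp r [:: RProj 1])) [:: rsnd; rfst]) => x.
  apply: eval_comp2 (eval_snd x) (eval_fst x) _.
  apply: (eval_prim_eq (h := fun _ z => den p z)); first exact: eval_proj.
    by move=> m z; apply: eval_comp1; [exact: eval_proj | exact: hr].
  by elim: (csnd x) => //= n <-.
Qed.

(* The induction schemes give no hypothesis under the existential of [ev_min],
   whence an explicit fixpoint on derivations. *)
Fixpoint eval_inj f xs y (h : eval f xs y) {struct h} :
  forall z, eval f xs z -> y = z
with evals_inj gs xs ys (h : evals gs xs ys) {struct h} :
  forall zs, evals gs xs zs -> ys = zs.
Proof.
- destruct h as [xs|xs|i xs|f gs xs ys y hgs hf|f g xs y hf|f g n xs z y hf hg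
    |f xs n h0 hlt].
  + by move=> u hu; inversion hu.
  + by move=> u hu; inversion hu.
  + by move=> u hu; inversion hu.
  + have := eval_inj _ _ _ hf; have := evals_inj _ _ _ hgs.
    move=> IHgs IHf u hu; inversion hu; subst.
    by apply: IHf; rewrite (IHgs _ H1).
  + have := eval_inj _ _ _ hf => IHf u hu; inversion hu; subst.
    exact: IHf.
  + have := eval_inj _ _ _ hf; have := eval_inj _ _ _ hg.
    move=> IHg IHf u hu; inversion hu; subst.
    by apply: IHg; rewrite (IHf _ H4).
  + have IH0 := eval_inj _ _ _ h0.
    have IH m : m < n -> exists v, forall z, eval f (m :: xs) z -> v.+1 = z.
      by move=> hm; case: (hlt m hm) => v hv; exists v; exact: (eval_inj _ _ _ hv).
    move=> u hu; inversion hu; subst.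
    case: (ltngtP n u) => // hnu; first by have [v /IH0] := H1 _ hnu.
    by have [v /(_ _ H0)] := IH _ hnu.
- destruct h as [xs|g gs xs y ys hg hgs]; first by move=> zs hzs; inversion hzs.
  have := eval_inj _ _ _ hg; have := evals_inj _ _ _ hgs.
  move=> IHgs IHg zs hzs; inversion hzs; subst.
  by rewrite (IHg _ H1) (IHgs _ H4).
Qed.

(** Unbounded minimization searches for a witness [p]. It looks for a zero, hence the test
    [1 - P c p]; determinism of [eval] turns a returned value back into a witness. *)
Lemma RE_search (S : finType) (L : seq S -> Prop) (P : nat -> nat -> bool) :
  primrec2 (fun c p => P c p) ->
  (forall w, L w <-> exists p, P (code_word w) p) -> RE L.
Proof.
move=> hP hL.
have [r hr] := primrec_recf (pr_sub (pr_const 1) hP).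
(* [RMin] puts the searched variable before the input, so the two are swapped. *)
pose s := RComp r [:: RComp rpair [:: RProj 1; RProj 0]].
have hs c p : eval s [:: p; c] (1 - P c p).
  apply: (@eval_comp1 _ _ _ (cpair c p)).
    by apply: eval_comp2; [exact: eval_proj..|exact: eval_pair].
  by have := hr (cpair c p); rewrite cfstK csndK.
exists (RMin s) => w; split.
  move=> /hL hex; exists (ex_minn hex); case: ex_minnP => n hn hmin.
  constructor; first by have := hs (code_word w) n; rewrite hn.
  move=> m hm; exists 0; have := hs (code_word w) m.
  by case: (boolP (P _ m)) => // /hmin; lia.
move=> [n hn]; apply/hL; exists n; inversion hn; subst.
by have := eval_inj H0 (hs _ _); case: (P _ _).
Qed.

(** * A universal machine and its diagonal language *)

Definition instr t a b := cpair t (cpair a b).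

Fixpoint pcode p :=
  match p with
  | PZero => instr 0 0 0
  | PSucc => instr 1 0 0
  | PFst => instr 2 0 0
  | PSnd => instr 3 0 0
  | PComp p q => instr 4 (pcode p) (pcode q)
  | PPair p q => instr 5 (pcode p) (pcode q)
  | PIter p => instr 6 (pcode p) 0
  end.

(* Machine states are [cpair v K], with current value [v] and a stack [K] of
   instructions. Tags 7, 8 and 9 are the continuations of a pair (second
   component pending, pairing pending) and of a loop (with its counter). *)
Definition exec v K t a b :=
  if t == 0 then cpair 0 K else
  if t == 1 then cpair v.+1 K else
  if t == 2 then cpair (cfst v) K else
  if t == 3 then cpair (csnd v) K else
  if t == 4 then cpair v (lcons b (lcons a K)) else
  if t == 5 then cpair v (lcons a (lcons (instr 7 b v) K)) else
  if t == 6 then cpair (cfst v) (lcons (instr 9 a (csnd v)) K) else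
  if t == 7 then cpair b (lcons a (lcons (instr 8 v 0) K)) else
  if t == 8 then cpair (cpair a v) K else
  if b == 0 then cpair v K else cpair v (lcons a (lcons (instr 9 a b.-1) K)).

Definition step z :=
  if csnd z == 0 then z else
  exec (cfst z) (ltl (csnd z)) (cfst (lhd (csnd z)))
    (cfst (csnd (lhd (csnd z)))) (csnd (csnd (lhd (csnd z)))).

Lemma pr_step_fun : primrec step.
Proof. rewrite /step /exec /instr; pr. Qed.

Lemma pr_iter N b (s : nat -> nat) :
  primrec N -> primrec b -> primrec s -> primrec (fun x => iter (N x) s (b x)).
Proof.
move=> hN hb hs; apply: (@eq_pr (fun x => iteri (N x) (fun _ => s) (b x))).
  by move=> x; elim: (N x) => //= n ->.
by apply: (@pr_iteri _ _ (fun _ _ => s)) => //; pr.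
Qed.

Lemma step_instr v t a b K :
  step (cpair v (lcons (instr t a b) K)) = exec v K t a b.
Proof. by rewrite /step !(cfstK, csndK) /= lhdK ltlK !(cfstK, csndK). Qed.

Definition steps x y := exists n, iter n step x = y.

Lemma steps_trans x y z : steps x y -> steps y z -> steps x z.
Proof. by move=> [n <-] [m <-]; exists (m + n); rewrite iterD. Qed.

Lemma steps_instr v t a b K y :
  steps (exec v K t a b) y -> steps (cpair v (lcons (instr t a b) K)) y.
Proof. by apply: steps_trans; exists 1; rewrite /= step_instr. Qed.

Lemma steps_refl x : steps x x. Proof. by exists 0. Qed.

(** Quantifying over the remaining stack [K] lets the induction run subprograms below pending
    continuations. *)
Lemma steps_pcode p v K :
  steps (cpair v (lcons (pcode p) K)) (cpair (den p v) K).
Proof.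
elim: p v K => [||||p IHp q IHq|p IHp q IHq|p IHp] v K /=; apply: steps_instr;
  rewrite /exec /=; try exact: steps_refl.
- exact: steps_trans (IHq _ _) (IHp _ _).
- apply: steps_trans (IHp _ _) _; apply: steps_instr; rewrite /exec /=.
  by apply: steps_trans (IHq _ _) _; apply: steps_instr; exact: steps_refl.
(* Induction on the loop counter, for every current value: one pass runs the body and leaves a loop
   with a smaller counter. *)
- elim: (csnd v) (cfst v) => [|n IH] u; apply: steps_instr; rewrite /exec /=.
    exact: steps_refl.
  by apply: steps_trans (IHp _ _) _; rewrite -iterS iterSr.
Qed.

Lemma iter_step_halted n v : iter n step (cpair v 0) = cpair v 0.
Proof. by elim: n => //= n ->; rewrite /step csndK. Qed.

(** A state with empty stack is fixed by [step], so both runs agree once extended to [n + m]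
    steps. *)
Lemma halted_uniq z v v' : steps z (cpair v 0) -> steps z (cpair v' 0) -> v = v'.
Proof.
move=> [n hn] [m hm]; rewrite -(cfstK v 0) -(cfstK v' 0).
rewrite -(iter_step_halted m v) -(iter_step_halted n v') -hn -hm -!iterD.
by rewrite addnC.
Qed.

(** This is $2^n-1$, the code of the unary word of length [n]. *)
Definition ucode n := iter n (fun c => 1 + 2 * c) 0.

Lemma code_word_unit n : code_word (nseq n tt) = ucode n.
Proof.
have h : enum_rank tt = 0 :> nat.
  by have := ltn_ord (enum_rank tt); rewrite [X in _ < X]card_unit; lia.
by elim: n => //= n ->; rewrite h [in X in _ + X]card_unit.
Qed.

Lemma ucode_inj : injective ucode.
Proof.
have h n : ucode n < ucode n.+1 by rewrite /= ; lia.
have hm := homo_ltn ltn_trans h.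
by move=> m n e; case: (ltngtP m n) => // /hm; rewrite e ltnn.
Qed.

(* The [n]-th unary word is read as the program with code [n]. *)
Definition diag_lang (w : seq unit) :=
  exists2 n, code_word w = ucode n &
    steps (cpair (code_word w) (lcons n 0)) (cpair 0 0).

Lemma RE_diag_lang : RE diag_lang.
Proof.
apply: (RE_search (P := fun c p => (c == ucode (cfst p)) &&
  (iter (csnd p) step (cpair c (lcons (cfst p) 0)) == cpair 0 0))).
  apply: pr_and; first apply: pr_eq; first by pr.
    by apply: pr_iter; pr.
  apply: pr_eq; last by pr.
  by apply: pr_iter; last exact: pr_step_fun; pr.
move=> w; split.
  move=> [n hn [t ht]]; exists (cpair n t).
  by rewrite cfstK csndK hn eqxx -hn ht eqxx.
by move=> [p /andP[/eqP hn /eqP ht]]; exists (cfst p) => //; exists (csnd p).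
Qed.

Definition primrec_lang (S : finType) (L : seq S -> Prop) :=
  exists2 b : nat -> bool, primrec (fun x => b x) &
    forall w, L w <-> b (code_word w).

Lemma primrec_lang_RE (S : finType) (L : seq S -> Prop) : primrec_lang L -> RE L.
Proof.
move=> [b hb hL]; apply: (RE_search (P := fun c _ => b c)).
  by apply: (pr_app hb); pr.
by move=> w; split=> [/hL|[_ /hL]] //; exists 0.
Qed.

(** If program [p] decided the language, then on the word of length [pcode p] it would output 0
    exactly when that word belongs to the language, that is, when it outputs 1. *)
Lemma diag_lang_not_primrec : ~ primrec_lang diag_lang.
Proof.
move=> [b [p hp] hL].
pose w := nseq (pcode p) tt; have hw : code_word w = ucode (pcode p).
  exact: code_word_unit.
have := steps_pcode p (code_word w) 0; rewrite hp => hs.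
case hb: (b (code_word w)) hs => hs.
  have /hL[n hn hs'] := hb.
  have en : n = pcode p by apply: ucode_inj; rewrite -hn.
  by move: hs'; rewrite en => /(halted_uniq hs).
have /hL : diag_lang w by exists (pcode p).
by rewrite hb.
Qed.

(** * Finitely generated subrings with decidable equality *)

Import Order.TTheory GRing.Theory Num.Theory.
Local Open Scope ring_scope.

(** An element may have many codes, so equality goes through [czero]. The code 0 must denote zero
    because it is the default entry of lists; one and subtraction come from [cneg1]. *)
Record coded_ring (F : numDomainType) := CodedRing {
  cval : nat -> F;
  cadd : nat -> nat -> nat;
  cmul : nat -> nat -> nat;
  czero : nat -> bool;
  cneg1 : nat;
  pr_cadd : primrec2 cadd;
  pr_cmul : primrec2 cmul;
  pr_czero : primrec (fun a => czero a);
  cval0 : cval 0%N = 0;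
  cvalD : forall a b, cval (cadd a b) = cval a + cval b;
  cvalM : forall a b, cval (cmul a b) = cval a * cval b;
  cvalN1 : cval cneg1 = -1;
  czeroE : forall a, czero a = (cval a == 0)
}.

(* A code [cpair a b] stands for the integer [a - b]. *)
Lemma coded_int (F : numDomainType) : coded_ring F.
Proof.
exists (fun n => (cfst n)%:R - (csnd n)%:R)
  (fun m n => cpair (cfst m + cfst n) (csnd m + csnd n))%N
  (fun m n => cpair (cfst m * cfst n + csnd m * csnd n)
                    (cfst m * csnd n + csnd m * cfst n))%N
  (fun n => cfst n == csnd n) (cpair 0 1).
- by rewrite /primrec2; pr.
- by rewrite /primrec2; pr.
- by pr.
- by rewrite -{1}(cfstK 0 0) -[X in csnd X](cfstK 0 0) subrr.
- by move=> a b; rewrite cfstK csndK !natrD; ring.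
- by move=> a b; rewrite cfstK csndK !natrD !natrM; ring.
- by rewrite cfstK csndK sub0r.
- by move=> a; rewrite subr_eq0 eqr_nat.
Qed.

(** * Adjoining one element to a coded ring *)

Section Extension.
Variables (F : numDomainType) (C : coded_ring F) (x : F).

Let hadd := pr_cadd C.
Let hmul := pr_cmul C.
Let hzero := pr_czero C.

(** Cutting at the code [l] loses no coefficient, since [l] bounds the length of its list. For the
    same reason [l + m] entries suffice for sums and products below. *)
Definition lpoly l : {poly F} := \poly_(i < l) cval C (lnth l i).

Lemma coef_lpoly l i : (lpoly l)`_i = cval C (lnth l i).
Proof. by rewrite coef_poly; case: ltnP => // /lnth_big ->; rewrite cval0. Qed.

Lemma lpoly_cons a l : lpoly (lcons a l) = (cval C a)%:P + 'X * lpoly l.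
Proof.
apply/polyP => -[|i]; rewrite coefD coefC coefXM !coef_lpoly ?lnth0 ?addr0 //.
by rewrite lnthS /= add0r.
Qed.

Lemma lpoly0 : lpoly 0%N = 0.
Proof. by apply/polyP => i; rewrite coef_poly coef0. Qed.

Definition csum (f : nat -> nat) n := iteri n (fun i a => cadd C (f i) a) 0%N.

Lemma cval_csum f n : cval C (csum f n) = \sum_(i < n) cval C (f i).
Proof.
elim: n => [|n IH]; first by rewrite big_ord0 /csum cval0.
by rewrite big_ord_recr /= cvalD -/(csum f n) IH addrC.
Qed.

Lemma pr_csum N (f : nat -> nat -> nat) :
  primrec N -> primrec2 f -> primrec (fun y => csum (f y) (N y)).
Proof.
move=> hN hf; apply: (@pr_iteri _ _ (fun y i a => cadd C (f y i) a)) => //; pr.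
Qed.

Definition ladd l m :=
  larr (mkseq (fun i => cadd C (lnth l i) (lnth m i)) (l + m)).

Lemma lpolyD l m : lpoly (ladd l m) = lpoly l + lpoly m.
Proof.
apply/polyP => i; rewrite coefD !coef_lpoly lnth_mkseq; case: ltnP => h.
  by rewrite cvalD.
by rewrite !lnth_big ?cval0 ?addr0 //; lia.
Qed.

Definition lmul l m :=
  larr (mkseq (fun i => csum (fun j => cmul C (lnth l j) (lnth m (i - j))) i.+1)
    (l + m)).

Lemma lpolyM l m : lpoly (lmul l m) = lpoly l * lpoly m.
Proof.
apply/polyP => i; rewrite coefM !coef_lpoly lnth_mkseq; case: ltnP => h.
  by rewrite cval_csum; apply: eq_bigr => j _; rewrite cvalM !coef_lpoly.
rewrite cval0 big1 // => j _; rewrite !coef_lpoly.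
case: (leqP l j) => hj; first by rewrite lnth_big // cval0 mul0r.
by rewrite [lnth m _]lnth_big ?cval0 ?mulr0 //; lia.
Qed.

(** The new codes are polynomials over [C], read through evaluation at [x]. Addition and
    multiplication carry over; only the zero test depends on [x]. *)
Lemma extension_of_zero_test (z : nat -> bool) :
  primrec (fun l => z l) -> (forall l, z l = ((lpoly l).[x] == 0)) ->
  exists C' : coded_ring F,
    (forall a, cval C' (lcons a 0) = cval C a) /\
    (exists a, cval C' a = x).
Proof.
move=> hz zE.
have h1 : primrec2 ladd by apply: pr_mkseq; rewrite /primrec2; pr.
have h2 : primrec2 lmul.
  apply: pr_mkseq; first by pr.
  apply: pr_csum; first by pr.
  by rewrite /primrec2; pr.
have e1 l m : (lpoly (ladd l m)).[x] = (lpoly l).[x] + (lpoly m).[x].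
  by rewrite lpolyD hornerD.
have e2 l m : (lpoly (lmul l m)).[x] = (lpoly l).[x] * (lpoly m).[x].
  by rewrite lpolyM hornerM.
have e0 : (lpoly 0%N).[x] = 0 by rewrite lpoly0 horner0.
have eC a : (lpoly (lcons a 0)).[x] = cval C a.
  by rewrite lpoly_cons lpoly0 mulr0 addr0 hornerC.
have eN : (lpoly (lcons (cneg1 C) 0)).[x] = -1 by rewrite eC cvalN1.
exists (CodedRing h1 h2 hz e0 e1 e2 eN zE); split => //=.
(* This list is the polynomial ['X], with 1 written as the square of -1. *)
exists (lcons 0 (lcons (cmul C (cneg1 C) (cneg1 C)) 0)).
by rewrite lpoly_cons hornerD hornerC hornerM hornerX eC cval0 cvalM cvalN1; ring.
Qed.

Lemma transcendental_zero_test :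
  (forall l, (lpoly l).[x] = 0 -> lpoly l = 0) ->
  exists2 z : nat -> bool, primrec (fun l => z l) &
    forall l, z l = ((lpoly l).[x] == 0).
Proof.
move=> hx; exists (fun l => all_below l (fun i => czero C (lnth l i))).
  by apply: pr_all_below; rewrite /primrec2; pr.
move=> l; apply/all_belowP/eqP => [h|/hx h i hi]; last first.
  by rewrite czeroE -coef_lpoly h coef0.
rewrite (_ : lpoly l = 0) ?horner0 //; apply/polyP => i; rewrite coef0.
rewrite coef_poly; case: ltnP => // /h.
by rewrite czeroE => /eqP.
Qed.

Section Algebraic.
(** Here [p] has degree [e.+1] and is least among nonzero polynomials vanishing at [x]; remainders
    occupy the indices 0 to [e]. *)
Variables (p e : nat).
Hypothesis sp : size (lpoly p) = e.+2.
Hypothesis px : (lpoly p).[x] = 0.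
Hypothesis pmin : forall l,
  (size (lpoly l) <= e.+1)%N -> (lpoly l).[x] = 0 -> lpoly l = 0.

Let a := lnth p e.+1.

Let a_neq0 : cval C a != 0.
Proof. by rewrite -coef_lpoly -[e.+1]/(e.+2.-1) -sp lead_coef_eq0 -size_poly_eq0 sp. Qed.

(* Pseudo-division by [p], reading the coefficients of [l] from the top. A state
   [cpair A r] satisfies [A * q = r] at [x], for [q] the part already read; the
   new coefficient [c] gives [a * A * (x * q + c) = a * x * r - t * p + a * A * c],
   where [t] is the top coefficient of [r]. *)
Definition reduce_step l j s :=
  cpair (cmul C (cfst s) a)
   (larr (mkseq (fun i =>
      cadd C (cadd C (cmul C a (lnth (lcons 0 (csnd s)) i))
                (cmul C (cneg1 C) (cmul C (lnth (csnd s) e) (lnth p i))))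
        (if i == 0%N then cmul C (cmul C (cfst s) a) (lnth l (l - j.+1)) else 0%N))
      e.+1)).

Definition reduce l n :=
  iteri n (reduce_step l) (cpair (cmul C (cneg1 C) (cneg1 C)) 0).

Lemma lpoly_size l n : (forall i, (n <= i)%N -> cval C (lnth l i) = 0) ->
  (size (lpoly l) <= n)%N.
Proof. by move=> h; apply/leq_sizeP => i hi; rewrite coef_lpoly h. Qed.

(** The loop invariant of pseudo-division. The multiplier is a power of the leading coefficient [a],
    hence nonzero in a domain. *)
Lemma reduceP l n : (n <= l)%N ->
  [/\ cval C (cfst (reduce l n)) != 0,
      (size (lpoly (csnd (reduce l n))) <= e.+1)%N &
      (lpoly (csnd (reduce l n))).[x] = cval C (cfst (reduce l n)) *
        (\poly_(i < n) cval C (lnth l (l - n + i))).[x]].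
Proof.
elim: n => [|n IH] hn.
  rewrite /reduce /= cfstK csndK lpoly0 size_poly0 cvalM cvalN1 mulrNN mulr1.
  by rewrite oner_neq0 poly_def big_ord0 horner0 mulr0.
have {IH} [] := IH (ltnW hn); rewrite /reduce iteriS -/(reduce l n).
set s := reduce l n => hA hs hx.
rewrite /reduce_step cfstK csndK; set r := larr _.
have er : lpoly r = (cval C a) *: ('X * lpoly (csnd s))
    - (cval C (lnth (csnd s) e)) *: lpoly p
    + (cval C (cfst s) * cval C a * cval C (lnth l (l - n.+1)))%:P.
  apply/polyP => i; rewrite coefD coefB !coefZ coefXM coefC !coef_lpoly lnth_mkseq.
  case: ltnP => hi.
    rewrite !cvalD !cvalM cvalN1 mulN1r; congr (_ * _ - _ + _).
      by case: i {hi} => [|i]; rewrite ?lnth0 ?cval0 // lnthS.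
    by case: eqP; rewrite ?cval0 // !cvalM.
  case: i hi => // i hi; rewrite /= cval0 addr0.
  (* At index [e.+1] the two leading terms cancel; above it both polynomials have zero
     coefficients. *)
  move: hi; rewrite ltnS leq_eqVlt => /predU1P[<-|hi].
    by rewrite mulrC subrr.
  have -> : cval C (lnth p i.+1) = 0.
    by rewrite -coef_lpoly nth_default // sp.
  by rewrite -[cval C (lnth _ i)]coef_lpoly nth_default ?mulr0 ?subr0 // (leq_trans hs).
split; first by rewrite cvalM mulf_neq0.
  by apply: lpoly_size => i hi; rewrite lnth_mkseq ltnNge hi /= cval0.
rewrite er !hornerE px hx cvalM.
(* Horner's rule: the newly read coefficient enters below those already read. *)
have -> : \poly_(i < n.+1) cval C (lnth l (l - n.+1 + i)) =
  (cval C (lnth l (l - n.+1)))%:P + 'X * \poly_(i < n) cval C (lnth l (l - n + i)).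
  apply/polyP => -[|i]; rewrite coefD coefC coefXM !coef_poly ?addn0 ?addr0 //=.
  by rewrite ltnS add0r; congr (if _ then cval C (lnth l _) else _); lia.
by rewrite !hornerE /=; ring.
Qed.

(** The remainder evaluates at [x] to a nonzero multiple of the value of [l]. By minimality of [p],
    it vanishes at [x] only if all its coefficients are zero, which [C] can test. *)
Lemma algebraic_zero_test :
  exists2 z : nat -> bool, primrec (fun l => z l) &
    forall l, z l = ((lpoly l).[x] == 0).
Proof.
exists (fun l => all_below e.+1 (fun i => czero C (lnth (csnd (reduce l l)) i))).
  apply: pr_all_below; first by pr.
  rewrite /primrec2; do 3 pr_step; last by pr.
  apply: (@pr_iteri _ _ (fun z => reduce_step (cfst z))); pr.
  apply: pr_pair; first by pr.
  by apply: pr_mkseq; rewrite /primrec2; pr.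
move=> l; have [hA hs hx] := reduceP (leqnn l).
have {}hx : (lpoly (csnd (reduce l l))).[x] =
    cval C (cfst (reduce l l)) * (lpoly l).[x].
  by rewrite hx subnn.
apply/all_belowP/eqP => [h|h0 i hi].
  apply: (mulfI hA); rewrite -hx mulr0 (_ : lpoly _ = 0) ?horner0 //.
  apply/polyP => i; rewrite coef0; case: (ltnP i e.+1) => hi.
    by rewrite coef_lpoly; apply/eqP; rewrite -czeroE h.
  by rewrite nth_default // (leq_trans hs).
by rewrite czeroE -coef_lpoly (pmin hs) ?coef0 // hx h0 mulr0.
Qed.

End Algebraic.

(** Whether [x] is algebraic over [C], and by which [p], is settled classically once and for all;
    only the dependence on [l] has to be primitive recursive. *)
Lemma zero_test : exists2 z : nat -> bool, primrec (fun l => z l) &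
  forall l, z l = ((lpoly l).[x] == 0).
Proof.
pose alg n := `[< exists l, [/\ lpoly l != 0, (lpoly l).[x] = 0 & size (lpoly l) = n] >].
have [hex|hnex] := pselect (exists n, alg n); last first.
  apply: transcendental_zero_test => l hl; apply/eqP/negPn/negP => h.
  by apply: hnex; exists (size (lpoly l)); apply/asboolP; exists l.
have [n /asboolP[p [p0 px sp]] hmin] := ex_minnP hex.
(* A nonzero constant has no root, so the least degree is positive. *)
have [e en] : exists e, n = e.+2.
  case: n sp {hmin} => [|[|n]] sp; last by exists n.
    by move: p0; rewrite -size_poly_eq0 sp.
  move/eqP/size_poly1P: sp px => [c c0 ->]; rewrite hornerC => c0'.
  by rewrite c0' eqxx in c0.
apply: (@algebraic_zero_test p e) => //; first by rewrite sp.
move=> l hl lx; apply/eqP/negPn/negP => l0.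
have /hmin : alg (size (lpoly l)) by apply/asboolP; exists l.
by rewrite en ltnNge hl.
Qed.

End Extension.

Lemma coded_ring_of_seq (F : numDomainType) (xs : seq F) :
  exists (C : coded_ring F) (code : F -> nat), {in xs, cancel code (cval C)}.
Proof.
elim: xs => [|x xs [C [code hcode]]]; first by exists (coded_int F), (fun=> 0%N).
have [z hz zE] := zero_test C x.
have [C' [hC' [a ha]]] := extension_of_zero_test hz zE.
(* Elements coded earlier become constant polynomials. *)
exists C', (fun y => if y == x then a else lcons (code y) 0) => y.
by rewrite inE; case: eqP => [-> //|_ /= /hcode]; rewrite hC'.
Qed.

(** * Bounded simulation of automata *)

Lemma pr_all (T : Type) (s : seq T) (P : T -> nat -> bool) :
  (forall t, primrec (fun x => P t x)) -> primrec (fun x => all (P^~ x) s).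
Proof.
by move=> hP; elim: s => [|t s IH] /=; [exact: (pr_const 1) | exact: pr_and].
Qed.

Lemma pr_has (T : Type) (s : seq T) (P : T -> nat -> bool) :
  (forall t, primrec (fun x => P t x)) -> primrec (fun x => has (P^~ x) s).
Proof.
by move=> hP; elim: s => [|t s IH] /=; [exact: (pr_const 0) | exact: pr_or].
Qed.

Lemma pr_neg (b : nat -> bool) :
  primrec (fun x => b x) -> primrec (fun x => ~~ b x).
Proof. by move=> hb; apply: eq_pr (pr_sub (pr_const 1) hb) => x; case: (b x). Qed.

Lemma size_code_word (S : finType) (w : seq S) : (size w <= code_word w)%N.
Proof. by elim: w => //= a w IH; nia. Qed.

(** Digits lie between 1 and [#|S|], below the base, so remainder and quotient recover the first
    letter and the rest. *)
Lemma code_word_inj (S : finType) : injective (@code_word S).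
Proof.
elim=> [|a u IH] [|b v] //= e.
have hb (c : S) w : ((enum_rank c).+1 + #|S|.+1 * w)%N =
    (w * #|S|.+1 + (enum_rank c).+1)%N by rewrite addnC mulnC.
move: e; rewrite !hb => e.
have hm := congr1 (modn^~ #|S|.+1) e; have hd := congr1 (divn^~ #|S|.+1) e.
move: hm hd; rewrite /= !modnMDl !divnMDl // !modn_small ?divn_small ?ltnS //.
by move=> [/val_inj/enum_rank_inj ->]; rewrite !addn0 => /IH ->.
Qed.

Lemma lnth_enum (T : finType) (f : T -> nat) (t : T) :
  lnth (larr [seq f t | t <- enum T]) (enum_rank t) = f t.
Proof.
by rewrite lnth_arr (nth_map t) ?nth_enum_rank // -cardE ltn_ord.
Qed.

Lemma eq_iteri (T : Type) n (f g : nat -> T -> T) x :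
  (forall i, (i < n)%N -> f i =1 g i) -> iteri n f x = iteri n g x.
Proof.
elim: n => //= n IH h; rewrite IH ?h // => i hi; apply: h; exact: ltnW.
Qed.

Section Simulation.
Variables (k : nat) (G : 'M[Cplx]_k -> Prop) (S : finType) (A : GAutomaton G S).
Variables (C : coded_ring Cplx) (code : Cplx -> nat).

Local Notation Q := (gstate A).
Local Notation transition := (Q * option S * (Q * 'M[Cplx]_k))%type.
Local Notation entry M i j := (lnth M (enum_rank (i, j))).

Let hadd := pr_cadd C.
Let hmul := pr_cmul C.
Let hzero := pr_czero C.

Definition transitions : seq transition :=
  [seq (x, p) | x <- enum {: Q * option S}, p <- gdelta x.1 x.2].

Lemma transitionsP q a p : ((q, a, p) \in transitions) = (p \in gdelta q a).
Proof.
apply/allpairsPdep/idP => [[[q' a']] [p'] [_ hp [-> -> ->]] //|hp].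
by exists (q, a), p; rewrite mem_enum.
Qed.

Hypothesis codeK : forall t, t \in transitions ->
  forall i j, cval C (code (t.2.2 i j)) = t.2.2 i j.

Definition cdot (f g : 'I_k -> nat) :=
  foldr (fun s a => cadd C (cmul C (f s) (g s)) a) 0%N (enum 'I_k).

Lemma cval_cdot f g :
  cval C (cdot f g) = \sum_s cval C (f s) * cval C (g s).
Proof.
rewrite /cdot -[RHS]big_enum /=.
elim: (enum 'I_k) => [|s r IH] /=; first by rewrite big_nil cval0.
by rewrite big_cons cvalD cvalM IH.
Qed.

Lemma pr_cdot (f g : 'I_k -> nat -> nat) :
  (forall s, primrec (f s)) -> (forall s, primrec (g s)) ->
  primrec (fun x => cdot (f^~ x) (g^~ x)).
Proof.
move=> hf hg; rewrite /cdot; elim: (enum _) => [|s r IH] /=; first by pr.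
by have hs := hf s; have hs' := hg s; pr.
Qed.

(* A code [cpair q (cpair u M)] describes a run from state [q] to a final state
   that reads [u] and multiplies the register by [M]. *)
Definition denotes z (q : Q) (u : seq S) (M : 'M[Cplx]_k) :=
  [/\ cfst z = enum_rank q, cfst (csnd z) = code_word u &
      forall i j, cval C (entry (csnd (csnd z)) i j) = M i j].

Definition oread (a : option S) (u : seq S) := if a is Some b then b :: u else u.

(* The state code [#|Q|] marks an inapplicable transition. *)
Definition prepend (t : transition) z :=
  cpair (if cfst z == enum_rank t.2.1 then enum_rank t.1.1 : nat else #|Q|)
  (cpair (if t.1.2 is Some b then (enum_rank b).+1 + #|S|.+1 * cfst (csnd z)
          else cfst (csnd z))%N
    (larr [seq cdot (fun s => code (t.2.2 ij.1 s))
                    (fun s => entry (csnd (csnd z)) s ij.2)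
          | ij <- enum {: 'I_k * 'I_k}])).

Lemma pr_prepend t f : primrec f -> primrec (fun x => prepend t (f x)).
Proof.
move=> hf; do 2?apply: pr_pair; [by pr | by case: t.1.2 => *; pr |].
apply: (pr_larr _ (f := fun ij x => cdot (fun s => code (t.2.2 ij.1 s))
                    (fun s => entry (csnd (csnd (f x))) s ij.2))) => ij.
by apply: pr_cdot => s; pr.
Qed.

Lemma denotes_prepend t z u M : t \in transitions -> denotes z t.2.1 u M ->
  denotes (prepend t z) t.1.1 (oread t.1.2 u) (t.2.2 *m M).
Proof.
move=> ht [hq hu hM]; rewrite /prepend; split; rewrite !(cfstK, csndK) ?hq ?eqxx //.
  by case: t.1.2 => //=; rewrite hu.
move=> i j; rewrite (lnth_enum (fun ij => cdot _ _)) cval_cdot mxE.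
by apply: eq_bigr => s _; rewrite codeK // hM.
Qed.

(** Transitions are numbered from 1; the number 0, like any number beyond the list, leaves the
    description unchanged. *)
Fixpoint select (ts : seq transition) e z :=
  if ts is t :: ts' then
    if e == 1%N then prepend t z else select ts' e.-1 z
  else z.

Lemma pr_select ts f g :
  primrec f -> primrec g -> primrec (fun x => select ts (f x) (g x)).
Proof.
move=> hf hg; elim: ts f hf => [|t ts IH] f hf //=.
by apply: pr_ite; [pr | exact: pr_prepend | apply: (IH (fun x => (f x).-1)); pr].
Qed.

Lemma select0 ts z : select ts 0 z = z.
Proof. by elim: ts. Qed.

Lemma select_mem ts t : t \in ts ->
  exists2 e, (e <= size ts)%N & forall z, select ts e z = prepend t z.
Proof.
elim: ts => // t' ts IH; rewrite inE => /predU1P[->|/IH[e he ht]]; first by exists 1%N.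
(* A number 0 stays 0: shifted to 1 it would select [t']. *)
case: e he ht => [|e] he ht; last by exists e.+2.
by exists 0%N.
Qed.

Lemma select_case ts e z : select ts e z = z \/
  exists2 t, t \in ts & select ts e z = prepend t z.
Proof.
elim: ts e => [|t ts IH] e /=; first by left.
case: eqP => _; first by right; exists t; rewrite ?mem_head.
case: (IH e.-1) => [->|[t' ht' ->]]; [by left|right; exists t' => //].
by rewrite inE ht' orbT.
Qed.

(** A certificate lists transition numbers in run order. It is replayed from the last one, starting
    at the final state, so that letters are consed onto the word without reversal. *)
Definition replay N c z :=
  iteri N (fun i => select transitions (lnth c (N - i.+1))) z.

Lemma pr_replay N f g : primrec N -> primrec f -> primrec g ->
  primrec (fun x => replay (N x) (f x) (g x)).
Proof.
move=> hN hf hg; apply: (@pr_iteri _ _ (fun x i z =>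
  select transitions (lnth (f x) (N x - i.+1)) z)) => //.
by apply: pr_select; pr.
Qed.

Lemma replay_cons N e c z :
  replay N.+1 (lcons e c) z = select transitions e (replay N c z).
Proof.
rewrite /replay iteriS subnn lnth0; congr select.
by apply: eq_iteri => i hi y; rewrite subSn // lnthS.
Qed.

Lemma replay0 N z : replay N 0 z = z.
Proof.
rewrite /replay; elim: N {-1}N => // N IH M.
by rewrite iteriS IH lnth_big // select0.
Qed.

Definition init (q : Q) :=
  cpair (enum_rank q) (cpair 0 (larr [seq
    if ij.1 == ij.2 then cmul C (cneg1 C) (cneg1 C) else 0%N
    | ij <- enum {: 'I_k * 'I_k}])).

Lemma denotes_init q : denotes (init q) q [::] 1%:M.
Proof.
split; rewrite !(cfstK, csndK) // => i j.
rewrite (lnth_enum (fun ij => if ij.1 == ij.2 then _ else _)) mxE /=.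
by case: eqP => _; rewrite ?cval0 // cvalM cvalN1 mulrNN mulr1.
Qed.

Lemma replay_sound qf c N q u M :
  denotes (replay N c (init qf)) q u M -> exists n, reach q 1%:M u n qf M.
Proof.
(* The invariant: a description is either marked inapplicable, which persists because [#|Q|] is no
   rank, or comes from a genuine run, valid for any initial register. *)
pose good z := cfst z = #|Q| \/ exists q u M, denotes z q u M /\
  exists n, forall x, reach q x u n qf (x *m M).
suff hg : good (replay N c (init qf)).
  move=> [h1 h2 h3]; case: hg => [h|[q' [u' [M' [[h1' h2' h3'] [n hn]]]]]].
    by have := ltn_ord (enum_rank q); rewrite -h1 h ltnn.
  have eq : q = q' by apply/enum_rank_inj/val_inj; rewrite /= -h1.
  have eu : u = u' by apply: code_word_inj; rewrite -h2.
  have eM : M = M' by apply/matrixP => i j; rewrite -h3.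
  by exists n; rewrite eq eu eM; have := hn 1%:M; rewrite mul1mx.
(* The length [L] that indexes the certificate stays fixed while the iteration count varies. *)
rewrite /replay; elim: N {-1}N => [|N IH] L.
  right; exists qf, [::], 1%:M; split; first exact: denotes_init.
  by exists 0%N => x; rewrite mulmx1; constructor.
rewrite iteriS; set z := iteri _ _ _; have {IH} hz : good z := IH L.
case: (select_case transitions (lnth c (L - N.+1)) z) => [->//|[[[q1 a] [q2 m]] ht ->]].
have [ez|nz] := eqVneq (cfst z) (enum_rank q2 : nat); last first.
  by left; rewrite /prepend cfstK /= (negPf nz).
case: hz => [h|[q' [u' [M' [hd [n hn]]]]]].
  by have := ltn_ord (enum_rank q2); rewrite -ez h ltnn.
have eq' : q' = q2.
  by case: hd => h _ _; apply/enum_rank_inj/val_inj; rewrite /= -h.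
rewrite {}eq' in hd hn.
right; exists q1, (oread a u'), (m *m M'); split.
  exact: (denotes_prepend (t := ((q1, a), (q2, m)))).
exists n.+1 => x; move: ht; rewrite transitionsP mulmxA => ht.
by case: a ht => [a|] ht; econstructor; eauto.
Qed.

(** The code of [N] copies of the largest transition number. As [lcons] is monotone, it bounds every
    certificate of length at most [N] with entries in range. *)
Definition certificate_bound N := iter N (lcons (size transitions)) 0%N.

Lemma pr_certificate_bound N :
  primrec N -> primrec (fun x => certificate_bound (N x)).
Proof. by move=> hN; apply: pr_iter; pr. Qed.

Lemma leq_lcons a a' l l' :
  (a <= a')%N -> (l <= l')%N -> (lcons a l <= lcons a' l')%N.
Proof. exact: leq_cpair. Qed.

Lemma leq_certificate_bound : {homo certificate_bound : m n / (m <= n)%N}.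
Proof.
apply: homo_leq => [//|n m p|n]; first exact: leq_trans.
by apply: leqW; exact: leq_addl.
Qed.

(** Each step of the run conses its number onto the certificate. One certificate serves every [N]
    from [n] on, since entries past its end are 0 and select nothing. *)
Lemma replay_complete q x u n qf y : reach q x u n qf y ->
  exists M, y = x *m M /\ exists2 c, (c <= certificate_bound n)%N &
    forall N, (n <= N)%N -> denotes (replay N c (init qf)) q u M.
Proof.
have step_ind q1 a q2 m u' n' qf' M c : (q2, m) \in gdelta q1 a ->
    (c <= certificate_bound n')%N ->
    (forall N, (n' <= N)%N -> denotes (replay N c (init qf')) q2 u' M) ->
    exists2 c, (c <= certificate_bound n'.+1)%N &
    forall N, (n'.+1 <= N)%N ->
      denotes (replay N c (init qf')) q1 (oread a u') (m *m M).
  rewrite -transitionsP => ht hc hd; have [e he es] := select_mem ht.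
  exists (lcons e c); first exact: leq_lcons.
  case=> // N hN; rewrite replay_cons es.
  exact: denotes_prepend ht (hd N hN).
elim=> {q x u n qf y}.
- move=> q x; exists 1%:M; rewrite mulmx1; split=> //; exists 0%N => // N _.
  by rewrite replay0; exact: denotes_init.
- move=> q x q2 m u n q' x' hm _ [M [-> [c hc hd]]].
  exists (m *m M); rewrite mulmxA; split=> //.
  exact: (step_ind _ None _ _ _ _ _ _ _ hm hc hd).
- move=> q x a q2 m u n q' x' hm _ [M [-> [c hc hd]]].
  exists (m *m M); rewrite mulmxA; split=> //.
  exact: (step_ind _ (Some a) _ _ _ _ _ _ _ hm hc hd).
Qed.

Definition is_one z :=
  all (fun ij => czero C (if ij.1 == ij.2
         then cadd C (entry (csnd (csnd z)) ij.1 ij.2) (cneg1 C)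
         else entry (csnd (csnd z)) ij.1 ij.2)) (enum {: 'I_k * 'I_k}).

Lemma is_oneP z q u M : denotes z q u M -> reflect (M = 1%:M) (is_one z).
Proof.
move=> [_ _ hM]; apply: (iffP allP) => [h|hM1 [i j] _].
  apply/matrixP => i j; have := h (i, j); rewrite mem_enum => /(_ isT).
  rewrite /= czeroE mxE; have [_|_] := boolP (i == j).
    by rewrite cvalD hM cvalN1 subr_eq0 => /eqP.
  by rewrite hM => /eqP.
rewrite /= czeroE; have [->|hij] /= := eqVneq i j.
  by rewrite cvalD hM hM1 mxE cvalN1 eqxx subrr.
by rewrite hM hM1 mxE (negPf hij).
Qed.

Definition accepting_replay N u qf c :=
  let z := replay N c (init qf) in
  [&& cfst z == enum_rank (gstart A), cfst (csnd z) == u & is_one z].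

(** The doubly negated [all_below] is a bounded existential search over certificates. *)
Definition simulate N u :=
  has (fun qf => ~~ all_below (certificate_bound N).+1
                   (fun c => ~~ accepting_replay N u qf c)) (enum (gaccept A)).

Lemma pr_simulate N : primrec N -> primrec (fun u => simulate (N u) u).
Proof.
move=> hN; apply: (pr_has _ (P := fun qf u => ~~ all_below _ _)) => qf.
apply: pr_neg; apply: pr_all_below.
  by apply: pr_succ; apply: pr_certificate_bound.
apply: pr_neg.
have hr : primrec (fun z => replay (N (cfst z)) (csnd z) (init qf)).
  by apply: pr_replay; pr.
apply: pr_and; first by apply: pr_eq; [exact: pr_fst|pr].
apply: pr_and; first by apply: pr_eq; [exact: pr_fst (pr_snd hr)|pr].
apply: (pr_all _ (P := fun ij z => czero C _)) => -[i j] /=.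
apply: (pr_app hzero); case: (i == j); [apply: (pr_app2 hadd); last by pr|];
  by apply: pr_nth; [exact: pr_snd (pr_snd hr)|pr].
Qed.

Lemma simulateP N w : simulate N (code_word w) ->
  exists n, accepts_in A w n.
Proof.
case/hasP => qf; rewrite mem_enum => hqf.
rewrite -has_predC => /hasP[c _] /=; rewrite negbK.
case/and3P => /eqP hq /eqP hw h1.
pose z := replay N c (init qf).
pose M := \matrix_(i < k, j < k) cval C (entry (csnd (csnd z)) i j).
have hd : denotes z (gstart A) w M by split=> // i j; rewrite mxE.
have [n hn] := replay_sound hd; exists n, qf; split=> //.
by rewrite ((is_oneP hd) h1) in hn.
Qed.

Lemma simulate_accepts N w n : (n <= N)%N -> accepts_in A w n ->
  simulate N (code_word w).
Proof.
move=> hn [qf [hqf /replay_complete [M [e [c hc hd]]]]].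
apply/hasP; exists qf; rewrite ?mem_enum // -has_predC; apply/hasP; exists c.
  by rewrite mem_iota ltnS (leq_trans hc) // leq_certificate_bound.
have {}hd := hd N hn; rewrite /= negbK; apply/and3P; split.
- by case: hd => -> _ _.
- by case: hd => _ -> _.
- by apply/(is_oneP hd); rewrite mul1mx in e.
Qed.

End Simulation.

(** The finitely many values before [n0] are absorbed into the additive constant. *)
Lemma bigO_lin_bound t : bigO_lin t -> exists c d, forall n, (t n <= c * n + d)%N.
Proof.
move=> [c [n0 h]]; exists c, (\max_(i < n0) t i)%N => n.
case: (leqP n0 n) => [/h h'|hn]; first exact: leq_trans h' (leq_addr _ _).
apply: leq_trans (leq_addl _ _).
exact: (leq_bigmax_cond (F := fun i : 'I_n0 => t i) (Ordinal hn)).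
Qed.

(** A successful simulation always yields a real accepting run; the time bound ensures that members
    of [L] are found within the search limit. *)
Lemma LGw_lin_primrec k (G : 'M[Cplx]_k -> Prop) (S : finType)
  (L : seq S -> Prop) : LGw_lin G L -> primrec_lang L.
Proof.
move=> [A [t [/bigO_lin_bound [c [d ht]] [hL hb]]]].
pose entries := [seq (x.2.2 : 'M_k) ij.1 ij.2
  | x <- transitions A, ij <- enum {: 'I_k * 'I_k}].
have [C [code hcode]] := coded_ring_of_seq entries.
have codeK x : x \in transitions A -> forall i j,
    cval C (code (x.2.2 i j)) = x.2.2 i j.
  move=> hx i j; apply: hcode; apply/allpairsP; exists (x, (i, j)).
  by rewrite mem_enum.
(* The code of a word is at least its length, so [c * u + d] bounds the number of steps. *)
exists (fun u => simulate A C code (c * u + d) u).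
  by apply: pr_simulate; pr.
move=> w; split=> [/hb [n [hn]]|].
  apply: simulate_accepts => //; apply: leq_trans hn (leq_trans (ht _) _).
  by rewrite leq_add2r leq_mul // size_code_word.
by move/(simulateP codeK)/hL.
Qed.

Theorem theorem4p14 (k : nat) (G : 'M[Cplx]_k -> Prop)
  (HG : is_matrix_group G)
  (Hcomp : forall A, G A -> forall i j, computable_complex (A i j)) :
  (forall (S : finType) (L : seq S -> Prop), LGw_lin G L -> RE L) /\
  (exists (S : finType) (L : seq S -> Prop), RE L /\ ~ LGw_lin G L).
Proof.
split=> [S L /LGw_lin_primrec|]; first exact: primrec_lang_RE.
exists unit, diag_lang; split; first exact: RE_diag_lang.
by move/LGw_lin_primrec; exact: diag_lang_not_primrec.
Qed.
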